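(* Let $A\in\mathbb{R}^{n\times n}$ and $B\in\mathbb{R}^{m\times m}$ have disjoint spectra and let $f\in\mathbb{R}^n$, $g\in\mathbb{R}^m$. For $j=1,\ldots,N$ let $\hat\Lambda^{(j)},\breve\Lambda^{(j)}\in\mathbb{C}^{s\times s}$ and $\beta^{(j)},\hat\beta^{(j)},\breve\beta^{(j)}\in\mathbb{C}^s$ be such that $\hat\mu\neq\hat\lambda^{-1}$ for all nonzero eigenvalues $\hat\lambda$ of $A$ and all eigenvalues $\hat\mu$ of $\hat\Lambda^{(j)}$, and $\breve\mu\neq-\breve\lambda^{-1}$ for all nonzero eigenvalues $\breve\lambda$ of $B$ and all eigenvalues $\breve\mu$ of $\breve\Lambda^{(j)}$. Let $Y_j,\hat h_j,\breve h_j$ be the iterates of the Runge-Kutta iteration for the Sylvester equation $A\mathcal{Y}-\mathcal{Y}B=fg^{\mathsf T}$ described in the context. If for all $j=1,\ldots,N$ $$\operatorname{diag}(\beta^{(j)})\overline{\breve\Lambda^{(j)}}+(\hat\Lambda^{(j)})^{\mathsf T}\operatorname{diag}(\beta^{(j)})-\beta^{(j)}(\beta^{(j)})^{\mathsf T}=0,\qquad \hat\beta^{(j)}=\beta^{(j)},\qquad \breve\beta^{(j)}=\overline{\beta^{(j)}},$$ then for all $j=1,\ldots,N$ $$AY_j-Y_jB-fg^{\mathsf T}=\hat h_j\breve h_j^{\mathsf H}.$$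
   Context: $\overline{X}$ is the entrywise complex conjugate, $X^{\mathsf T}$ the transpose and $X^{\mathsf H}$ the conjugate transpose; $\operatorname{diag}(\beta)$ is the diagonal matrix with diagonal $\beta$. Runge-Kutta iteration for the Sylvester equation (all time step sizes equal to $1$): set $Y_0=0\in\mathbb{C}^{n\times m}$, $\hat h_0=f$, $\breve h_0=-g$. For $j=1,\ldots,N$: (1) let $\hat K_j\in\mathbb{C}^{n\times s}$ be the unique solution of $\hat K_j=[A\hat h_{j-1},\ldots,A\hat h_{j-1}]+A\hat K_j(\hat\Lambda^{(j)})^{\mathsf T}$ and let $\breve K_j\in\mathbb{C}^{m\times s}$ be the unique solution of $\breve K_j=[-B^{\mathsf T}\breve h_{j-1},\ldots,-B^{\mathsf T}\breve h_{j-1}]-B^{\mathsf T}\breve K_j(\breve\Lambda^{(j)})^{\mathsf T}$ (vectors repeated $s$ times); (2) $\hat{\mathcal H}_j=[\hat h_{j-1},\ldots,\hat h_{j-1}]+\hat K_j(\hat\Lambda^{(j)})^{\mathsf T}$ and $\breve{\mathcal H}_j=[\breve h_{j-1},\ldots,\breve h_{j-1}]+\breve K_j(\breve\Lambda^{(j)})^{\mathsf T}$; (3) $Y_j=Y_{j-1}+\hat{\mathcal H}_j\operatorname{diag}(\beta^{(j)})\breve{\mathcal H}_j^{\mathsf H}$; (4) $\hat h_j=\hat h_{j-1}+\hat K_j\hat\beta^{(j)}$ and $\breve h_j=\breve h_{j-1}+\breve K_j\breve\beta^{(j)}$. *)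

(* Defs.v *)
From mathcomp Require Import all_boot all_order all_algebra spectral complex.
From mathcomp Require Import classical_sets reals.

Set Implicit Arguments.
Unset Strict Implicit.
Unset Printing Implicit Defensive.
Import Order.TTheory GRing.Theory Num.Theory.
Local Open Scope ring_scope.
Local Open Scope classical_set_scope.
Local Open Scope sesquilinear_scope.

Definition complexify (R : realType) m n (M : 'M[R]_(m, n)) : 'M[R[i]]_(m, n) :=
  map_mx (real_complex R) M.

Definition repeat_col (C : numClosedFieldType) n s (v : 'cV[C]_n) : 'M[C]_(n, s) :=
  \matrix_(i, j) v i 0.

(* One Runge-Kutta step of size 1 for the linear problem h' = M h; the columns
   of K are the stage derivatives, L is the coefficient matrix. *)
Definition stage_equation (C : numClosedFieldType) n s (M : 'M[C]_n)
    (L : 'M[C]_s) (h : 'cV[C]_n) (K : 'M[C]_(n, s)) : Prop :=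
  K = repeat_col s (M *m h) + M *m K *m L^T.

(* The definite description "the unique K such that ...": the value is the
   junk default 0 unless there is exactly one solution, so anything proved
   about it has to establish existence and uniqueness first. *)
Definition stage_derivs (C : numClosedFieldType) n s (M : 'M[C]_n)
    (L : 'M[C]_s) (h : 'cV[C]_n) : 'M[C]_(n, s) :=
  xget 0 [set K | unique (stage_equation M L h) K].

Definition stage_values (C : numClosedFieldType) n s (M : 'M[C]_n)
    (L : 'M[C]_s) (h : 'cV[C]_n) : 'M[C]_(n, s) :=
  repeat_col s h + stage_derivs M L h *m L^T.

(* [L j] and [b j] are the coefficients used in the j-th step, which goes from
   the iterate j - 1 to the iterate j; [L 0] and [b 0] are never used. *)
Fixpoint rk_iter (C : numClosedFieldType) n s (M : 'M[C]_n)
    (L : nat -> 'M[C]_s) (b : nat -> 'cV[C]_s) (h0 : 'cV[C]_n) (j : nat) :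
    'cV[C]_n :=
  if j is k.+1 then
    let h := rk_iter M L b h0 k in h + stage_derivs M (L j) h *m b j
  else h0.

Section SylvesterRK.

Variables (C : numClosedFieldType) (n m s : nat).
Variables (A : 'M[C]_n) (B : 'M[C]_m) (f : 'cV[C]_n) (g : 'cV[C]_m).
Variables (Lhat Lbreve : nat -> 'M[C]_s) (beta bhat bbreve : nat -> 'cV[C]_s).

Definition h_hat (j : nat) : 'cV[C]_n := rk_iter A Lhat bhat f j.

Definition h_breve (j : nat) : 'cV[C]_m := rk_iter (- B^T) Lbreve bbreve (- g) j.

Fixpoint sylvester_iter (j : nat) : 'M[C]_(n, m) :=
  if j is k.+1 then
    sylvester_iter k +
      stage_values A (Lhat j) (h_hat k) *m diag_mx (beta j)^T
        *m (stage_values (- B^T) (Lbreve j) (h_breve k)) ^t*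
  else 0.

End SylvesterRK.

(* Main.v *)
Require Import Defs.
From mathcomp Require Import all_boot all_order all_algebra spectral complex.
From mathcomp Require Import classical_sets reals.
Set Implicit Arguments.
Unset Strict Implicit.
Unset Printing Implicit Defensive.
Import Order.TTheory GRing.Theory Num.Theory.
Local Open Scope ring_scope.
Local Open Scope sesquilinear_scope.

(** For real [B] and [M = - B^T], conjugate-transposing the stage equation
    [K = M H] gives [K^H = - H^H B].  Hence the residual [A Y - Y B - f g^T]
    changes in one step by [K D H'^H + H D K'^H], where [D = diag_mx beta^T] and
    the primes mark the second iteration.  Expanding the stage values H, H' in
    terms of the stage derivatives K, K' turns the terms quadratic in the
    derivatives into [K (D conj(L') + L^T D) K'^H = (K beta) (K' conj(beta))^H],
    so the change is exactly that of [h h'^H].  All this requires that the stage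
    equations are solvable, which is where the spectral hypotheses enter. *)

Lemma unitmx_eigenvalue (F : fieldType) n (M : 'M[F]_n) (a : F) :
  ~~ eigenvalue M a -> M - a%:M \in unitmx.
Proof. by rewrite /eigenvalue negbK kermx_eq0 row_free_unit. Qed.

(** For nonzero [mu] this is [- mu] times [M - mu^-1]; for [mu = 0] it is the identity, so the zero
    eigenvalue of [M] needs no exclusion. *)
Lemma unitmx_1subZ (F : fieldType) n (M : 'M[F]_n) (mu : F) :
  (mu != 0 -> ~~ eigenvalue M mu^-1) -> 1%:M - mu *: M \in unitmx.
Proof.
have [->|mu0] := eqVneq mu 0; first by rewrite scale0r subr0 unitmx1.
move=> /(_ isT)/unitmx_eigenvalue Mu.
suff -> : 1%:M - mu *: M = (- mu) *: (M - mu^-1%:M).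
  by rewrite unitmxZ // unitfE oppr_eq0.
by rewrite scalerBr scale_scalar_mx mulNr divff // raddfN opprK scaleNr addrC.
Qed.

Lemma eigenvalueNtr (F : fieldType) n (M : 'M[F]_n) (a : F) :
  eigenvalue (- M^T) a = eigenvalue M (- a).
Proof.
rewrite /eigenvalue !kermx_eq0 !row_free_unit; congr (~~ _).
rewrite -[in RHS]unitmx_tr -[RHS](unitmxZ _ (unitrN1 F)) scaleN1r.
by rewrite raddfB /= tr_scalar_mx raddfN opprK opprD.
Qed.

(* Each factor [L - z] of the polynomial can be cancelled: it commutes with L,
   so it preserves the solution set, and [L X = z X] turns the equation into
   [X (1 - z M^T) = 0]. *)
Lemma fixed_eq0_horner (F : fieldType) s n (M : 'M[F]_n) (L : 'M[F]_s.+1)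
    (r : seq F) (X : 'M[F]_(s.+1, n)) :
    {in r, forall z, 1%:M - z *: M \in unitmx} ->
    X = L *m X *m M^T ->
    horner_mx L (\prod_(z <- r) ('X - z%:P)) *m X = 0 ->
  X = 0.
Proof.
elim: r X => [|a r IHr] X Hr HX; first by rewrite big_nil rmorph1 mul1mx.
rewrite big_cons mulrC rmorphM rmorphB /= horner_mx_X horner_mx_C -mulmxA => H.
have {IHr H} H0 : (L - a%:M) *m X = 0.
  apply: IHr H; first by move=> z zr; apply: Hr; rewrite inE zr orbT.
  rewrite {1}HX !mulmxBl !mulmxBr !mulmxBl !mul_scalar_mx !mulmxA.
  by rewrite -!scalemxAr -!scalemxAl.
have LX : L *m X = a *: X.
  by apply/eqP; rewrite -subr_eq0 -mul_scalar_mx -mulmxBl H0.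
have Hu : (1%:M - a *: M)^T \in unitmx by rewrite unitmx_tr Hr ?mem_head.
rewrite -(mulmxK Hu X) raddfB /= linearZ /= trmx1 mulmxBr mulmx1 -scalemxAr.
by rewrite scalemxAl -LX -HX subrr mul0mx.
Qed.

Section Stages.
Variables (C : numClosedFieldType) (n s : nat) (M : 'M[C]_n) (L : 'M[C]_s).
Hypothesis unitML : forall mu, eigenvalue L mu -> 1%:M - mu *: M \in unitmx.

(** Over a closed field the characteristic polynomial of [L] splits, its roots are the eigenvalues
    of [L], and by Cayley-Hamilton it annihilates [K^T]. *)
Lemma stage_fixed_eq0 (K : 'M[C]_(n, s)) : K = M *m K *m L^T -> K = 0.
Proof.
(* [horner_mx] needs a nonempty square matrix; for [s = 0] the matrix [K] has no columns. *)
case: s L unitML K => [|s'] L' uML K HK; first exact: thinmx0.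
apply: trmx_inj; rewrite trmx0.
have [r Hr] := closed_field_poly_normal (char_poly L').
apply: (@fixed_eq0_horner _ _ _ M L' r).
- move=> z zr; apply: uML; rewrite eigenvalue_root_char Hr.
  by rewrite (monicP (char_poly_monic _)) scale1r root_prod_XsubC.
- by rewrite {1}HK !trmx_mul trmxK mulmxA.
- move: Hr; rewrite (monicP (char_poly_monic _)) scale1r => <-.
  by rewrite Cayley_Hamilton mul0mx.
Qed.

(** The map [K - M K L^T] is an injective endomorphism of a finite-dimensional space, hence
    surjective; [lin_mx] turns it into an invertible matrix. *)
Lemma stage_solvable (G : 'M[C]_(n, s)) : exists K, K = G + M *m K *m L^T.
Proof.
pose T := idfun \- (mulmxr L^T \o mulmx M) : 'M[C]_(n, s) -> 'M[C]_(n, s).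
have /eqP uT : row_free (lin_mx T).
  apply: inj_row_free => v; rewrite mul_rV_lin /= => /(canRL mxvecK).
  rewrite raddf0 => /eqP; rewrite subr_eq0 => /eqP/stage_fixed_eq0 Hv.
  by rewrite -[v]vec_mxK Hv raddf0.
have uT' : lin_mx T \in unitmx by rewrite -row_free_unit; apply/eqP.
exists (vec_mx (mxvec G *m invmx (lin_mx T))); set v := _ *m _.
have : v *m lin_mx T = mxvec G by rewrite mulmxKV.
by rewrite mul_rV_lin => /(can_inj mxvecK) /= /(canRL (subrK _)).
Qed.

(** Existence and uniqueness together rule out the default value of [xget]. *)
Lemma stage_derivsP (h : 'cV[C]_n) : stage_equation M L h (stage_derivs M L h).
Proof.
have [K HK] := stage_solvable (repeat_col s (M *m h)).
suff [] : [set K | unique (stage_equation M L h) K]%classic (stage_derivs M L h).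
  by [].
apply: xgetI (K) _; split=> // K' HK'; apply/eqP; rewrite -subr_eq0; apply/eqP.
apply: stage_fixed_eq0; rewrite {1}HK {1}HK' mulmxBr mulmxBl.
by rewrite opprD addrACA subrr add0r.
Qed.

Lemma stage_derivsE (h : 'cV[C]_n) :
  stage_derivs M L h = M *m stage_values M L h.
Proof.
rewrite {1}stage_derivsP /stage_values mulmxDr mulmxA; congr (_ + _).
by apply/matrixP => i j; rewrite !mxE; apply: eq_bigr => k _; rewrite mxE.
Qed.

End Stages.

(** The rank-one form makes the repeated columns accessible to matrix algebra. *)
Lemma repeat_colE (C : numClosedFieldType) n s (h : 'cV[C]_n) :
  repeat_col s h = h *m const_mx 1.
Proof. by apply/matrixP => i j; rewrite !mxE big_ord1 mxE mulr1. Qed.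

Lemma const1_mul_diag (C : pzRingType) s (b : 'cV[C]_s) :
  const_mx 1 *m diag_mx b^T = b^T :> 'rV_s.
Proof. by apply/rowP => j; rewrite mul_mx_diag !mxE mul1r. Qed.

Lemma diag_mul_const1 (C : pzRingType) s (b : 'cV[C]_s) :
  diag_mx b^T *m const_mx 1 = b :> 'cV_s.
Proof. by apply/colP => j; rewrite mul_diag_mx !mxE mulr1. Qed.

Section Step.
Variables (C : numClosedFieldType) (n m s : nat).
Variables (A : 'M[C]_n) (B : 'M[C]_m) (Lh Lb : 'M[C]_s) (b : 'cV[C]_s).
Hypothesis realB : map_mx Num.conj B = B.
Hypothesis unitA :
  forall mu, eigenvalue Lh mu -> 1%:M - mu *: A \in unitmx.
Hypothesis unitB :
  forall mu, eigenvalue Lb mu -> 1%:M - mu *: (- B^T) \in unitmx.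
Hypothesis order_cond : diag_mx b^T *m map_mx Num.conj Lb + Lh^T *m diag_mx b^T
  - b *m b^T = 0.

Lemma sylvester_step (h : 'cV[C]_n) (k : 'cV[C]_m) :
  let W := stage_values A Lh h *m diag_mx b^T
             *m (stage_values (- B^T) Lb k) ^t* in
  A *m W - W *m B =
    (h + stage_derivs A Lh h *m b)
      *m (k + stage_derivs (- B^T) Lb k *m map_mx Num.conj b) ^t*
    - h *m k ^t*.
Proof.
have EK := stage_derivsE unitA h; have EK' := stage_derivsE unitB k.
rewrite /=.
move: order_cond => ord; set D := diag_mx b^T in ord *.
have EKH : (stage_derivs (- B^T) Lb k) ^t* =
    - (stage_values (- B^T) Lb k) ^t* *m B.
  rewrite EK' trmx_mul map_mxM [(- B^T)^T]raddfN /= trmxK map_mxN.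
  by rewrite realB mulmxN mulNmx.
have -> : A *m (stage_values A Lh h *m D *m (stage_values (- B^T) Lb k) ^t*) -
   stage_values A Lh h *m D *m (stage_values (- B^T) Lb k) ^t* *m B =
   stage_derivs A Lh h *m D *m (stage_values (- B^T) Lb k) ^t* +
   stage_values A Lh h *m D *m (stage_derivs (- B^T) Lb k) ^t*.
  by rewrite EKH EK mulNmx mulmxN !mulmxA.
rewrite /stage_values !repeat_colE.
set K := stage_derivs A Lh h; set K' := stage_derivs (- B^T) Lb k.
(* The order condition, multiplied by [K] on the left and [K'^H] on the right. *)
have quad : K *m D *m (map_mx Num.conj Lb *m K' ^t*) + K *m Lh^T *m D *m K' ^t* =
    K *m b *m (b^T *m K' ^t*).
  move/eqP: ord; rewrite subr_eq0 => /eqP Hord.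
  by rewrite !mulmxA -mulmxDl -(mulmxA K) -(mulmxA K) -mulmxDr Hord !mulmxA.
have -> : (k *m const_mx 1 + K' *m Lb^T) ^t* =
    (const_mx 1 : 'cV_s) *m k ^t* + map_mx Num.conj Lb *m K' ^t*.
  rewrite raddfD /= map_mxD !trmx_mul !map_mxM /= trmxK trmx_const.
  by rewrite map_const_mx rmorph1.
have -> : (k + K' *m map_mx Num.conj b) ^t* = k ^t* + b^T *m K' ^t*.
  rewrite raddfD /= map_mxD trmx_mul map_mxM; congr (_ + _ *m _).
  by apply/rowP => j; rewrite !mxE; exact: conjCK.
rewrite !(mulmxDr, mulmxDl) !mulmxA.
(* The mixed terms become [K b k^H] and [h b^T K'^H], as in the expanded product of the updated
   vectors. *)
rewrite -(mulmxA K D) diag_mul_const1 -(mulmxA h) const1_mul_diag.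
move: quad; rewrite !mulmxA => <-.
by rewrite addrACA [RHS]addrC -(addrA (h *m k ^t*)) addKr !addrA.
Qed.

End Step.

Lemma complexify_real (R : realType) m n (M : 'M[R]_(m, n)) :
  map_mx Num.conj (complexify M) = complexify M.
Proof.
apply/matrixP => i j; rewrite !mxE; apply/eqP.
by rewrite eq_complex /= oppr0 !eqxx.
Qed.

Theorem mainTheorem5 (R : realType) (n m s N : nat)
    (A : 'M[R]_n) (B : 'M[R]_m) (f : 'cV[R]_n) (g : 'cV[R]_m)
    (Lhat Lbreve : nat -> 'M[R[i]]_s) (beta bhat bbreve : nat -> 'cV[R[i]]_s) :
  (forall z : R[i],
     ~ (eigenvalue (complexify A) z /\ eigenvalue (complexify B) z)) ->
  (forall j : nat, (1 <= j <= N)%N -> forall lam mu : R[i],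
     eigenvalue (complexify A) lam -> lam != 0 ->
     eigenvalue (Lhat j) mu -> mu != lam^-1) ->
  (forall j : nat, (1 <= j <= N)%N -> forall lam mu : R[i],
     eigenvalue (complexify B) lam -> lam != 0 ->
     eigenvalue (Lbreve j) mu -> mu != - lam^-1) ->
  (forall j : nat, (1 <= j <= N)%N ->
     [/\ diag_mx (beta j)^T *m map_mx Num.conj (Lbreve j)
           + (Lhat j)^T *m diag_mx (beta j)^T - beta j *m (beta j)^T = 0,
         bhat j = beta j
       & bbreve j = map_mx Num.conj (beta j)]) ->
  forall j : nat, (1 <= j <= N)%N ->
    let Y := sylvester_iter (complexify A) (complexify B) (complexify f)
               (complexify g) Lhat Lbreve beta bhat bbreve in
    let hhat := h_hat (complexify A) (complexify f) Lhat bhat in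
    let hbreve := h_breve (complexify B) (complexify g) Lbreve bbreve in
    complexify A *m Y j - Y j *m complexify B - complexify f *m (complexify g)^T
      = hhat j *m (hbreve j) ^t*.
Proof.
move=> _ HA HB Hbeta j /andP[_ jN] Y hhat hbreve.
elim: j jN => [_|j IHj jN].
  (* Initially the residual is [- f g^T], which equals [f (- g)^H] because [g] is real. *)
  rewrite /hhat /hbreve /h_hat /h_breve /= mulmx0 mul0mx subr0 sub0r.
  by rewrite raddfN map_mxN mulmxN /= map_trmx complexify_real.
have j1N : (1 <= j.+1 <= N)%N by rewrite jN.
have [ord bhatE bbreveE] := Hbeta _ j1N.
have uA mu : eigenvalue (Lhat j.+1) mu -> 1%:M - mu *: complexify A \in unitmx.
  move=> Hmu; apply: unitmx_1subZ => mu0; apply/negP => Hlam.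
  by have := HA _ j1N _ _ Hlam (invr_neq0 mu0) Hmu; rewrite invrK eqxx.
have uB mu : eigenvalue (Lbreve j.+1) mu ->
    1%:M - mu *: (- (complexify B)^T) \in unitmx.
  move=> Hmu; apply: unitmx_1subZ => mu0; apply/negP.
  (* An eigenvalue [mu^-1] of [- B^T] is an eigenvalue [- mu^-1] of [B], so [HB] applies with
     [lam = - mu^-1]. *)
  rewrite eigenvalueNtr => Hlam.
  have lam0 : - mu^-1 != 0 by rewrite oppr_eq0 invr_eq0.
  by have := HB _ j1N _ _ Hlam lam0 Hmu; rewrite invrN invrK opprK eqxx.
have /= step := sylvester_step (complexify_real B) uA uB ord (hhat j) (hbreve j).
have -> : hhat j.+1 = hhat j
    + stage_derivs (complexify A) (Lhat j.+1) (hhat j) *m beta j.+1.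
  by rewrite -bhatE.
have -> : hbreve j.+1 = hbreve j
    + stage_derivs (- (complexify B)^T) (Lbreve j.+1) (hbreve j)
        *m map_mx Num.conj (beta j.+1).
  by rewrite -bbreveE.
(* The previous residual, known by induction, cancels the subtracted product in [step]. *)
rewrite -/(hhat j) -/(hbreve j) mulmxDr (mulmxDl (Y j)).
by rewrite opprD addrACA step [LHS]addrAC IHj ?(ltnW jN) // addrC subrK.
Qed.
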